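(* Let $(R,\mathfrak m,k)$ be a Noetherian local ring with $\operatorname{ms}(R)=n$. The collection $$\left\{(x_1+\mathfrak m^2,\dots,x_n+\mathfrak m^2)\in\left(\mathfrak m/\mathfrak m^2\right)^{\oplus n} : x_i\in\mathfrak m\setminus\mathfrak m^2 \text{ for all } i \text{ and } \mathfrak m^2=(x_1,\dots,x_n)\mathfrak m\right\}$$ is a nonempty Zariski open set, where $\mathfrak m/\mathfrak m^2$ is identified with the affine space $\mathbb A^r_k$, $r=\mu(\mathfrak m)$, via a fixed minimal generating set of $\mathfrak m$.
   Context: Rings are commutative with unity; $k=R/\mathfrak m$ is the residue field. For an ideal $I$, $\mu(I)=\dim_k(I/\mathfrak m I)$ is its minimal number of generators. Define $$\operatorname{ms}(R)=\min\{\mu(I): I\subseteq\mathfrak m \text{ is an ideal of } R \text{ with } I\supseteq\mathfrak m^2\}.$$ Thus $(\mathfrak m/\mathfrak m^2)^{\oplus n}$ is identified with (the $k$-points of) $\mathbb A_k^{rn}$ with its Zariski topology. *)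

(* Defs.v *)
From HB Require Import structures.
From mathcomp Require Import all_boot all_algebra.
From mathcomp Require Import boolp classical_sets.
From mathcomp Require Import mpoly.

Set Implicit Arguments.
Unset Strict Implicit.
Unset Printing Implicit Defensive.

Import GRing.Theory.

Local Open Scope classical_set_scope.
Local Open Scope quotient_scope.
Local Open Scope ring_scope.

(* An ideal of R is an R-submodule of R.  Membership is a boolean as everywhere
   in MathComp; since boolp is available this excludes no ideal. *)
Notation ideal R := (submodClosed R^o).

Section Ideals.
Variable R : comNzRingType.
Implicit Types (S : set R) (I J : ideal R).

Definition span S : {pred R^o} :=
  fun x => `[< forall I : ideal R, (forall y, S y -> (y : R^o) \in I) ->
                 x \in I >].

Lemma span_submod_closed S : GRing.submod_closed (span S).
Proof.
split=> [|a x y /asboolP Sx /asboolP Sy]; apply/asboolP => I SI.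
  exact: rpred0.
by rewrite rpredD ?rpredZ ?Sx ?Sy.
Qed.

HB.instance Definition _ S :=
  GRing.isSubmodClosed.Build R R^o (span S) (span_submod_closed S).

Definition ideal_gen S : ideal R := span S.

Definition ideal_mul I J : ideal R :=
  ideal_gen [set z | exists x y : R^o, [/\ x \in I, y \in J & z = x * y]].

Definition fin_gen I : Prop := exists s : seq R, I =i ideal_gen [set` s].

Definition noetherian : Prop := forall I, fin_gen I.

Definition maximal_ideal I : Prop :=
  (1 : R^o) \notin I /\
  forall J, {subset I <= J} -> J =i I \/ (1 : R^o) \in J.

End Ideals.

Record maxIdeal (R : comNzRingType) := MaxIdeal {
  max_ideal :> ideal R;
  max_idealP : maximal_ideal max_ideal
}.

Definition local_ring (R : comNzRingType) (m : maxIdeal R) : Prop :=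
  forall m' : maxIdeal R, m' =i m.

Section ResidueField.
Variables (R : comNzRingType) (m : maxIdeal R).

Definition max_pred : {pred R} := fun x => (x : R^o) \in m.

Lemma max_pred_idealr_closed : idealr_closed max_pred.
Proof.
split=> [||a x y mx my]; rewrite /in_mem /= /max_pred.
- exact: (rpred0 m).
- exact: (max_idealP m).1.
- exact: (rpredD (rpredZ a mx) my).
Qed.

HB.instance Definition _ := isIdealr.Build R max_pred max_pred_idealr_closed.

Definition residue_field := {ideal_quot max_pred}.
HB.instance Definition _ := GRing.ComNzRing.on residue_field.

Definition res (x : R) : residue_field := \pi_({ideal_quot max_pred}) x.
HB.instance Definition _ :=
  GRing.RMorphism.copy res \pi_({ideal_quot max_pred}).

Lemma res_surj (u : residue_field) : exists x, res x = u.
Proof. by exists (repr u); rewrite /res reprK. Qed.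

Lemma res_eq (x y : R) : (res x == res y) = ((x - y : R^o) \in m).
Proof. by rewrite /res -Quotient.idealrBE. Qed.

Lemma res_eq0 (x : R) : (res x == 0) = ((x : R^o) \in m).
Proof. by rewrite -(rmorph0 res) res_eq subr0. Qed.

Definition res_inv (u : residue_field) : residue_field :=
  xget 0 [set v | v * u = 1].

Lemma res_mulVf (u : residue_field) : u != 0 -> res_inv u * u = 1.
Proof.
move=> u0; rewrite /res_inv; case: xgetP => [v _ //|noinv]; exfalso.
have [x xu] := res_surj u.
pose J : ideal R := ideal_gen [set z : R | (z : R^o) \in m \/ z = x].
have mJ : {subset m <= J}.
  by move=> z mz; apply/asboolP => I; apply; left.
have xJ : (x : R^o) \in J by apply/asboolP => I; apply; right.
pose K : {pred R^o} := fun z => `[< exists a b : R^o, b \in m /\ z = a * x + b >].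
have Kcl : GRing.submod_closed K.
  split=> [|c y z /asboolP[a [b [mb ->]]] /asboolP[a' [b' [mb' ->]]]];
    apply/asboolP.
    by exists 0, 0; rewrite mul0r addr0 rpred0.
  exists (c *: a + a'), (c *: b + b'); rewrite rpredD ?rpredZ//; split=> //.
  by rewrite scalerDr scalerAl mulrDl addrACA.
pose Kid := GRing.isSubmodClosed.Build R R^o K Kcl.
pose KI : ideal R := HB.pack K Kid.
have : (1 : R^o) \in J.
  case: ((max_idealP m).2 J mJ) => // Jm; move: u0.
  by rewrite -xu res_eq0 -Jm xJ.
move=> /asboolP/(_ KI)/= K1.
have /asboolP[a [b [mb e]]] : (1 : R^o) \in K.
  apply: K1 => z [mz|->]; apply/asboolP.
    by exists 0, z; rewrite mul0r add0r.
  by exists 1, 0; rewrite mul1r addr0 rpred0.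
apply: (noinv (res a)); rewrite /= -xu -rmorphM -(rmorph1 res); apply/eqP.
by rewrite eq_sym res_eq e [_ - _]addrC addKr.
Qed.

Lemma res_inv0 : res_inv 0 = 0.
Proof.
rewrite /res_inv; case: xgetP => [v _ /= /eqP|//].
by rewrite mulr0 eq_sym oner_eq0.
Qed.

HB.instance Definition _ :=
  GRing.ComNzRing_isField.Build residue_field res_mulVf res_inv0.

End ResidueField.

Section Fiber.
Variables (R : comNzRingType) (m : maxIdeal R) (I : ideal R).

Record ideal_elt := IdealElt { ideal_val :> R^o; _ : ideal_val \in I }.

HB.instance Definition _ := [isSub for ideal_val].
HB.instance Definition _ := [Choice of ideal_elt by <:].
HB.instance Definition _ := [SubChoice_isSubLmodule of ideal_elt by <:].

Definition fiber_pred : {pred ideal_elt} := fun x => val x \in ideal_mul m I.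

Lemma fiber_pred_zmod_closed : zmod_closed fiber_pred.
Proof.
split=> [|x y mx my]; first exact: (rpred0 (ideal_mul m I)).
exact: (rpredB (S := ideal_mul m I) mx my).
Qed.

HB.instance Definition _ :=
  GRing.isZmodClosed.Build ideal_elt fiber_pred fiber_pred_zmod_closed.

(* The k-vector space I/mI, with scalars acting through representatives. *)
Definition fiber := {ideal_quot fiber_pred}.
HB.instance Definition _ := GRing.Zmodule.on fiber.

Definition fiber_class (x : ideal_elt) : fiber := \pi_({ideal_quot fiber_pred}) x.
HB.instance Definition _ :=
  GRing.Additive.copy fiber_class \pi_({ideal_quot fiber_pred}).

Lemma fiber_class_surj (v : fiber) : exists x, fiber_class x = v.
Proof. by exists (repr v); rewrite /fiber_class reprK. Qed.

Lemma fiber_class_eq (x y : ideal_elt) :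
  (fiber_class x == fiber_class y) = (val (x - y) \in ideal_mul m I).
Proof. by rewrite /fiber_class -Quotient.idealrBE. Qed.

Definition fiber_scale (a : residue_field m) (v : fiber) : fiber :=
  fiber_class (repr a *: repr v).

Lemma mem_ideal_mul (x y : R^o) :
  x \in m -> y \in I -> x * y \in ideal_mul m I.
Proof. by move=> mx Iy; apply/asboolP => J; apply; exists x, y. Qed.

Lemma fiber_scaleE (a : R) (x : ideal_elt) :
  fiber_scale (res m a) (fiber_class x) = fiber_class (a *: x).
Proof.
rewrite /fiber_scale; set a' := repr _; set x' := repr _.
have /eqP : res m a' = res m a by rewrite /res reprK.
have /eqP : fiber_class x' = fiber_class x by rewrite /fiber_class reprK.
rewrite fiber_class_eq res_eq => xx' aa'; apply/eqP; rewrite fiber_class_eq.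
have -> : a' *: x' - a *: x = a *: (x' - x) + (a' - a) *: x'.
  by rewrite scalerBr scalerBl [RHS]addrC subrKA.
rewrite raddfD /= rpredD //; first exact: (rpredZ a xx').
by apply: mem_ideal_mul => //; exact: (valP x').
Qed.

Lemma fiber_scalerA a b v :
  fiber_scale a (fiber_scale b v) = fiber_scale (a * b) v.
Proof.
have [[x <-] [y <-]] := (res_surj a, res_surj b).
have [z <-] := fiber_class_surj v.
by rewrite -rmorphM !fiber_scaleE scalerA.
Qed.

Lemma fiber_scale1r : left_id 1 fiber_scale.
Proof.
move=> v; have [z <-] := fiber_class_surj v.
by rewrite -(rmorph1 (res m)) fiber_scaleE scale1r.
Qed.

Lemma fiber_scalerDr : right_distributive fiber_scale +%R.
Proof.
move=> a v w; have [x <-] := res_surj a.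
have [[y <-] [z <-]] := (fiber_class_surj v, fiber_class_surj w).
by rewrite -raddfD !fiber_scaleE scalerDr raddfD.
Qed.

Lemma fiber_scalerDl v : {morph fiber_scale^~ v : a b / a + b}.
Proof.
move=> a b /=; have [[x <-] [y <-]] := (res_surj a, res_surj b).
have [z <-] := fiber_class_surj v.
by rewrite -rmorphD !fiber_scaleE scalerDl raddfD.
Qed.

HB.instance Definition _ :=
  GRing.Zmodule_isLmodule.Build (residue_field m) fiber
    fiber_scalerA fiber_scale1r fiber_scalerDr fiber_scalerDl.

End Fiber.

Section Dimension.
Variables (k : fieldType) (V : lmodType k).

Definition lincomb (r : nat) (v : 'I_r -> V) (c : 'rV[k]_r) : V :=
  \sum_j c 0 j *: v j.

Lemma lincomb_linear r (v : 'I_r -> V) : linear (lincomb v).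
Proof.
move=> a x y; rewrite /lincomb scaler_sumr -big_split; apply: eq_bigr => j _ /=.
by rewrite !mxE scalerDl scalerA.
Qed.

HB.instance Definition _ r (v : 'I_r -> V) :=
  GRing.isLinear.Build k 'rV[k]_r V _ (lincomb v) (lincomb_linear v).

Lemma spanned_basis r (v : 'I_r -> V) : (forall w, exists c, lincomb v c = w) ->
  exists2 d, (d <= r)%N & inhabited (Vector.axiom d V).
Proof.
elim: r v => [|r IHr] v vspan; last first.
  have [[c cn0 c0]|ninj] := pselect (exists2 c, c != 0 & lincomb v c = 0).
    have [i ci] : exists i, c 0 i != 0.
      apply: contrapT => /forallNP ci; case/eqP: cn0; apply/rowP => i.
      by rewrite mxE; apply/eqP/negPn/negP.
    case: (IHr (v \o lift i)) => [w|d dr Vd]; last by exists d => //; exact: leqW.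
    have [b <-] := vspan w.
    pose b' := - (b 0 i / c 0 i) *: c + b.
    have bi : b' 0 i = 0 by rewrite !mxE mulNr divfK // addNr.
    have <- : lincomb v b' = lincomb v b.
      by rewrite (lincomb_linear v) c0 scaler0 add0r.
    exists (\row_j b' 0 (lift i j)).
    rewrite /lincomb (bigD1_ord i) //= bi scale0r add0r.
    by apply: eq_bigr => j _; rewrite mxE.
  exists r.+1 => //.
  have inj : injective (lincomb v).
    move=> x y xy; apply/eqP; rewrite -subr_eq0; apply/negPn/negP => xy0.
    by apply: ninj; exists (x - y); rewrite // linearB /= xy subrr.
  have [g gK] := choice vspan.
  have Kg : cancel (lincomb v) g by move=> c; apply: inj; rewrite gK.
  constructor; exists g; last by exists (lincomb v).
  by move=> a x y; apply: inj; rewrite linearP /= !gK.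
exists 0%N => //; constructor.
have V0 (w : V) : w = 0 by have [c <-] := vspan w; rewrite /lincomb big_ord0.
exists (fun=> 0); first by move=> a x y; apply/rowP => -[].
by exists (fun=> 0) => x; [rewrite [x]V0 | rewrite [x]thinmx0].
Qed.

Lemma basis_uniq d d' : inhabited (Vector.axiom d V) ->
  inhabited (Vector.axiom d' V) -> d = d'.
Proof.
move=> [[f flin [f' fK f'K]]] [[g glin [g' gK g'K]]].
suff le a b (p : V -> 'rV[k]_a) (q : V -> 'rV[k]_b) (p' : 'rV_a -> V) :
    linear p -> linear q -> cancel p' p -> cancel p p' -> injective q ->
    (a <= b)%N.
  by apply/eqP; rewrite eqn_leq; apply/andP; split;
    [apply: (le _ _ f g f') | apply: (le _ _ g f g')] => //; exact: can_inj.
move=> plin qlin pK p'K qinj.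
have p'lin : linear p'.
  by move=> c x y; apply: (can_inj p'K); rewrite plin !pK.
have hlin : linear (q \o p') by move=> c x y /=; rewrite p'lin qlin.
pose hL := GRing.isLinear.Build _ _ _ _ (q \o p') hlin.
pose h : {linear 'rV[k]_a -> 'rV[k]_b} := HB.pack (q \o p') hL.
suff : row_free (lin1_mx h) by move=> /eqP <-; exact: rank_leq_col.
rewrite -kermx_eq0 -submx0; apply/rV_subP => x /sub_kermxP.
rewrite mul_rV_lin1 /= => hx0.
suff -> : x = 0 by rewrite sub0mx.
apply: (can_inj pK); apply: qinj; rewrite [LHS]hx0.
by have /= := linear0 h => ->.
Qed.

End Dimension.

(* Both numbers default to 0 when there is no value to pick, which for a
   Noetherian local ring never happens. *)
Section Numbers.
Variables (R : comNzRingType) (m : maxIdeal R).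

Definition mu (I : ideal R) : nat :=
  xget 0 [set d : nat |
    inhabited (Vector.axiom d (fiber m I : lmodType (residue_field m)))].

Lemma muE (I : ideal R) d :
  inhabited (Vector.axiom d (fiber m I : lmodType (residue_field m))) ->
  mu I = d.
Proof. by move=> Id; rewrite /mu; case: xgetP => [e _ /basis_uniq|/(_ d)//]; apply. Qed.

Definition mu_values : set nat :=
  [set d | exists I : ideal R,
     [/\ {subset I <= m}, {subset ideal_mul m m <= I} & mu I = d]].

Definition ms : nat :=
  xget 0 [set d : nat | mu_values d /\ forall e, mu_values e -> (d <= e)%N].

End Numbers.

(* Zariski topology on the k-points of an affine space. *)
Definition zariski_open (k : fieldType) (N : nat) (U : set 'rV[k]_N) : Prop :=
  exists S : set {mpoly k[N]},
    U = [set v | exists2 p, S p & p.@[fun i => v 0 i] != 0].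

Section Reductions.
Variables (R : comNzRingType) (m : maxIdeal R).

Definition minimal_generators (r : nat) (e : 'I_r -> ideal_elt m) : Prop :=
  mu m m = r /\ m =i ideal_gen (range (fun j => val (e j))).

(* The identification k^(nr) -> (m/m^2)^n, a point of the affine space being
   an n x r matrix of coordinates. *)
Definition coord_map (n r : nat) (e : 'I_r -> ideal_elt m)
    (v : 'rV[residue_field m]_(n * r)) : {ffun 'I_n -> fiber m m} :=
  [ffun i => \sum_j (vec_mx v i j) *: fiber_class m (e j)].

Lemma minimal_generators_span r (e : 'I_r -> ideal_elt m) (w : fiber m m) :
  minimal_generators e -> exists c, lincomb (@fiber_class R m m \o e) c = w.
Proof.
move=> [_ me]; have [x <-] := fiber_class_surj w.
pose K : {pred R^o} :=
  fun z => `[< exists c : 'I_r -> R, z = \sum_j c j *: val (e j) >].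
have Kcl : GRing.submod_closed K.
  split=> [|a y z /asboolP[c ->] /asboolP[c' ->]]; apply/asboolP.
    by exists (fun=> 0); rewrite big1 // => j _; rewrite scale0r.
  exists (fun j => a * c j + c' j); rewrite scaler_sumr -big_split.
  by apply: eq_bigr => j _; rewrite scalerDl scalerA.
pose KI : ideal R := HB.pack K (GRing.isSubmodClosed.Build R R^o K Kcl).
have xm : val x \in ideal_gen (range (fun j => val (e j))).
  by rewrite -me; exact: valP.
have /asboolP[c xc] : val x \in K.
  move/asboolP: xm => /(_ KI); apply => _ [j _ <-]; apply/asboolP.
  exists (fun i => (i == j)%:R); rewrite (bigD1 j) //= eqxx scale1r big1 ?addr0//.
  by move=> i /negPf ->; rewrite scale0r.
have -> : x = \sum_j c j *: e j.
  by apply: val_inj; rewrite [LHS]xc raddf_sum.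
exists (\row_j res m (c j)); rewrite /lincomb raddf_sum; apply: eq_bigr => j _ /=.
by rewrite mxE -fiber_scaleE.
Qed.

Lemma coord_map_bij n r (e : 'I_r -> ideal_elt m) :
  minimal_generators e -> bijective (@coord_map n r e).
Proof.
move=> emin; have espan w := minimal_generators_span w emin.
have [d dr Vd] := spanned_basis espan; have dE := muE Vd.
rewrite emin.1 in dE; subst r; case: Vd => -[f flin [f' fK f'K]].
have hlin : linear (f \o lincomb (@fiber_class R m m \o e)).
  by move=> c x y /=; rewrite linearP /= flin.
pose hL := GRing.isLinear.Build _ _ _ _ _ hlin.
pose h : {linear 'rV_d -> 'rV_d} :=
  HB.pack (f \o lincomb (@fiber_class R m m \o e)) hL.
have hfull : row_full (lin1_mx h).
  rewrite -sub1mx; apply/row_subP => i.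
  have [c cE] := espan (f' (row i 1%:M)).
  by apply/submxP; exists c; rewrite mul_rV_lin1 /= cE f'K.
have inj : injective (lincomb (@fiber_class R m m \o e)).
  move=> x y xy; have : row_free (lin1_mx h) by rewrite /row_free.
  by move=> /row_free_inj; apply; rewrite !mul_rV_lin1 /= xy.
have [g gK] := choice espan.
have cE A i : coord_map e (mxvec A) i = lincomb (@fiber_class R m m \o e) (row i A).
  by rewrite /coord_map ffunE; apply: eq_bigr => j _; rewrite mxvecK mxE.
exists (fun t : {ffun 'I_n -> fiber m m} => mxvec (\matrix_i g (t i))) => [v|t].
  rewrite -[v]vec_mxK; congr mxvec; apply/row_matrixP => i.
  by rewrite rowK cE; apply: inj; rewrite gK.
by apply/ffunP => i; rewrite cE rowK gK.
Qed.

Definition reduction_tuples (n : nat) : set {ffun 'I_n -> fiber m m} :=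
  [set t | exists x : 'I_n -> ideal_elt m,
     [/\ t = [ffun i => fiber_class m (x i)],
         forall i, val (x i) \notin ideal_mul m m &
         ideal_mul m m =i
           ideal_mul (ideal_gen (range (fun i => val (x i)))) m]].

End Reductions.

(* Main.v *)
(* Nonemptiness: among the families of [ms R] elements of [m] generating an
   ideal that contains [m^2], Steinitz exchange produces one, [x], whose classes
   in [m/m^2] are linearly independent.  An element [\sum c_i x_i] of [m^2] then
   has all its coefficients in [m], so [m^2 = (x) m].
   Openness: by Nakayama, [m^2 = (x) m] if and only if the classes of the
   products [x_i e_l] span [m^2/m^3].  They are linear in the coordinates of
   [x], and spanning amounts to the nonvanishing of a determinant. *)

Require Import Defs.
From HB Require Import structures.
From mathcomp Require Import all_boot all_algebra.
From mathcomp Require Import boolp classical_sets.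
From mathcomp Require Import mpoly.

Set Implicit Arguments.
Unset Strict Implicit.
Unset Printing Implicit Defensive.

Import GRing.Theory.

Local Open Scope classical_set_scope.
Local Open Scope ring_scope.

(** * Ideals: generating families and products *)

Section Ideals.
Variable R : comNzRingType.
Implicit Types (I J K : ideal R) (S : set R).

Lemma sub_ideal_gen S x : S x -> (x : R^o) \in ideal_gen S.
Proof. by move=> Sx; apply/asboolP => I; apply. Qed.

Lemma ideal_gen_sub S I :
  (forall x, S x -> (x : R^o) \in I) -> {subset ideal_gen S <= I}.
Proof. by move=> SI x /asboolP/(_ I SI). Qed.

(** The generated ideal is defined as an intersection. Combinations of the [g i] form an ideal [K]
    that contains every [g i], so [K] contains the intersection. *)
Lemma ideal_genP s (g : 'I_s -> R) (x : R) :
  (x : R^o) \in ideal_gen (range g) <-> exists c, x = \sum_i c i * g i.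
Proof.
split=> [xg|[c ->]]; last first.
  apply: rpred_sum => i _; apply: (rpredZ (c i : R)).
  by apply: sub_ideal_gen; exists i.
pose K : {pred R^o} :=
  fun z => `[< exists c : 'I_s -> R, (z : R) = \sum_i c i * g i >].
have Kcl : GRing.submod_closed K.
  split=> [|a y z /asboolP[c ->] /asboolP[c' ->]]; apply/asboolP.
    by exists (fun=> 0); rewrite big1 // => i _; rewrite mul0r.
  exists (fun i => a * c i + c' i); rewrite scaler_sumr -big_split.
  by apply: eq_bigr => i _; rewrite mulrDl -mulrA.
pose KI : ideal R := HB.pack K (GRing.isSubmodClosed.Build R R^o K Kcl).
apply/asboolP; apply: (@ideal_gen_sub (range g) KI) xg => _ [i _ <-].
apply/asboolP; exists (fun j => (j == i)%:R).
rewrite (bigD1 i) //= eqxx mul1r big1 ?addr0// => j /negPf ->.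
by rewrite mul0r.
Qed.

Lemma ideal_mulS I J (x y : R) :
  (x : R^o) \in I -> (y : R^o) \in J -> (x * y : R^o) \in ideal_mul I J.
Proof. by move=> Ix Jy; apply: sub_ideal_gen; exists x, y. Qed.

Lemma ideal_mul_sub I J K :
  (forall x y : R, (x : R^o) \in I -> (y : R^o) \in J -> (x * y : R^o) \in K) ->
  {subset ideal_mul I J <= K}.
Proof. by move=> IJK; apply: ideal_gen_sub => _ [x [y [Ix Jy ->]]]; exact: IJK. Qed.

Lemma ideal_mulC I J : ideal_mul I J =i ideal_mul J I.
Proof.
have sub I' J' : {subset ideal_mul I' J' <= ideal_mul J' I'}.
  by apply: ideal_mul_sub => x y xI yJ; rewrite mulrC ideal_mulS.
by move=> x; apply/idP/idP; exact: sub.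
Qed.

Lemma ideal_mul_subr I J : {subset ideal_mul I J <= J}.
Proof. by apply: ideal_mul_sub => x y _ Jy; exact: (rpredZ x Jy). Qed.

(** Multiplying a combination of the [g i] by an element of [J] moves all its coefficients into [J],
    and combinations with coefficients in [J] form an ideal. *)
Lemma ideal_mul_genP I J s (g : 'I_s -> R) (x : R) :
  I =i ideal_gen (range g) ->
  (x : R^o) \in ideal_mul J I <->
  exists2 c, forall i, (c i : R^o) \in J & x = \sum_i c i * g i.
Proof.
move=> Ig; split=> [xJI|[c cJ ->]]; last first.
  apply: rpred_sum => i _; apply: ideal_mulS => //.
  by rewrite Ig; apply: sub_ideal_gen; exists i.
pose K : {pred R^o} := fun z => `[< exists2 c : 'I_s -> R,
  forall i, (c i : R^o) \in J & (z : R) = \sum_i c i * g i >].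
have Kcl : GRing.submod_closed K.
  split=> [|a y z /asboolP[c cJ ->] /asboolP[c' cJ' ->]]; apply/asboolP.
    by exists (fun=> 0) => [i|]; rewrite ?rpred0// big1 // => i _; rewrite mul0r.
  exists (fun i => a * c i + c' i) => [i|].
    exact: (rpredD (rpredZ (a : R) (cJ i)) (cJ' i)).
  rewrite scaler_sumr -big_split.
  by apply: eq_bigr => i _; rewrite mulrDl -mulrA.
pose KI : ideal R := HB.pack K (GRing.isSubmodClosed.Build R R^o K Kcl).
apply/asboolP; apply: (@ideal_mul_sub J I KI) xJI => a y aJ.
rewrite Ig => /ideal_genP[c ->]; apply/asboolP; exists (fun i => a * c i).
  by move=> i; rewrite mulrC; exact: (rpredZ (c i : R) aJ).
by rewrite mulr_sumr; apply: eq_bigr => i _; rewrite mulrA.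
Qed.

Lemma fin_gen_family I :
  fin_gen I -> exists s (g : 'I_s -> R), I =i ideal_gen (range g).
Proof.
move=> [s Is]; exists (size s), (tnth (in_tuple s)) => x; rewrite Is.
suff -> : range (tnth (in_tuple s)) = [set` s] by [].
apply/seteqP; split=> y /=; first by move=> [i _ <-]; exact: mem_tnth.
by move=> /(@tnthP _ _ (in_tuple s))[i ->]; exists i.
Qed.

End Ideals.

(** * Units of a local ring and Nakayama's lemma *)

Section Local.
Variables (R : comNzRingType) (m : maxIdeal R) (Rlocal : local_ring m).
Implicit Types (I J : ideal R).

(** By Zorn's lemma a nonunit lies in some maximal ideal, which is [m] because the ring is local. *)
Lemma local_unit (a : R) : (a : R^o) \notin m -> exists b, b * a = 1.
Proof.
move=> am; apply: contrapT => /forallNP nunit.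
(* [A !=set0 -> A a] rather than [A a], so that the union of the empty chain
   qualifies. *)
pose P (A : set R) := [/\ forall c x y, A x -> A y -> A (c * x + y), ~ A 1
  & A !=set0 -> A a].
have [A [[Alin A1 A0] Amax]] : exists A, P A /\ forall B, A `<` B -> ~ P B.
  apply: Zorn_bigcup => F FP Ftot; split=> [c x y [X FX Xx] [Y FY Yy]||].
  - by have [XY|YX] := Ftot _ _ FX FY; [exists Y | exists X] => //;
      [have [Yl _ _] := FP _ FY; apply: Yl => //; exact: XY
      |have [Xl _ _] := FP _ FX; apply: Xl => //; exact: YX].
  - by move=> [X /FP[_ + _]].
  - by move=> [x [X FX Xx]]; exists X => //; have [_ _] := FP _ FX; apply; exists x.
(* Otherwise [A] would be empty, and the proper ideal of multiples of [a] would be strictly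
   larger. *)
have Aa : A a.
  apply: contrapT => nAa; apply: (Amax [set z | exists c, z = c * a]).
    split=> [x Ax|BA]; first by exfalso; apply/nAa/A0; exists x.
    by apply/nAa/BA; exists 1; rewrite mul1r.
  split=> [c _ _ [d ->] [d' ->]|[c /esym]|_]; last by exists 1; rewrite mul1r.
    by exists (c * d + d'); rewrite mulrDl mulrA.
  exact: nunit.
pose K : {pred R^o} := fun z => `[< A z >].
have Kcl : GRing.submod_closed K.
  split=> [|c x y /asboolP Ax /asboolP Ay]; apply/asboolP; last exact: Alin.
  by rewrite -(addNr a) -mulN1r; exact: Alin.
pose KI : ideal R := HB.pack K (GRing.isSubmodClosed.Build R R^o K Kcl).
have Kmax : maximal_ideal KI.
  split=> [|J KJ]; first exact/asboolPn.
  have [|J1] := boolP ((1 : R^o) \in J); [by right | left].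
  apply: contrapT => JK; apply: (Amax [set x : R | (x : R^o) \in J]).
    split=> [x Ax|JA]; first by apply: KJ; apply/asboolP.
    apply: JK => x; apply/idP/idP => [Jx|/KJ//].
    by apply/asboolP; exact: JA.
  split=> [c x y Jx Jy||_]; [exact: (rpredD (rpredZ c Jx) Jy) | exact/negP |].
  by apply: KJ; apply/asboolP.
move/negP: am; apply; rewrite -(Rlocal (MaxIdeal Kmax)).
exact/asboolP.
Qed.

(** Determinant trick: a matrix [B], congruent to the identity modulo [m], sends the generators of
    [I] to elements of [J]. Its determinant is a unit, so multiplying by the adjugate recovers the
    generators inside [J]. *)
Lemma nakayama I J : fin_gen I ->
  (forall x : R^o, x \in I -> exists2 y, y \in J & x - y \in ideal_mul m I) ->
  {subset I <= J}.
Proof.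
move=> /fin_gen_family[s [g Ig]] IJ.
have /choice[y /all_and2[yJ]] i :
    exists y : R, (y : R^o) \in J /\ (g i - y : R^o) \in ideal_mul m I.
  have [|y yJ yI] := IJ (g i); last by exists y.
  by rewrite Ig; apply: sub_ideal_gen; exists i.
move=> gy; have /choice[A AE] i : exists c : 'I_s -> R,
    (forall j, (c j : R^o) \in m) /\ g i - y i = \sum_j c j * g j.
  by have /(ideal_mul_genP _ _ Ig)[c cm ce] := gy i; exists c.
pose B : 'M[R]_s := 1%:M - \matrix_(i, j) A i j.
have By : B *m (\col_i g i) = \col_i y i.
  rewrite mulmxBl mul1mx; apply/colP => i; rewrite !mxE.
  have [_ yE] := AE i; rewrite -[RHS](subKr (g i)) yE.
  by congr (_ - _); apply: eq_bigr => j _; rewrite !mxE.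
have detB : (\det B : R^o) \notin m.
  rewrite -res_eq0 -det_map_mx map_mxB map_mx1.
  suff -> : map_mx (res m) (\matrix_(i, j) A i j) = 0 by rewrite subr0 det1 oner_eq0.
  by apply/matrixP => i j; rewrite !mxE; apply/eqP; rewrite res_eq0; have [] := AE i.
have [b bB] := local_unit detB.
move=> x; rewrite Ig; move: x; apply: ideal_gen_sub => _ [i _ <-].
have : \adj B *m (B *m \col_i g i) = \adj B *m \col_i y i by rewrite By.
rewrite mulmxA mul_adj_mx mul_scalar_mx => /colP/(_ i); rewrite !mxE => e.
rewrite -(mul1r (g i)) -bB -mulrA e; apply: (rpredZ b).
by apply: rpred_sum => j _; rewrite [X in _ * X]mxE; exact: (rpredZ (\adj B i j) (yJ j)).
Qed.

End Local.

(** Sums of ideals are encoded below as ideals generated by unions; this splits their elements. *)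
Lemma ideal_gen_setU (R : comNzRingType) (S T : set R) (x : R) :
  (x : R^o) \in ideal_gen (S `|` T) ->
  exists u v : R, [/\ (u : R^o) \in ideal_gen S, (v : R^o) \in ideal_gen T
    & x = u + v].
Proof.
pose K : {pred R^o} := fun z => `[< exists u v : R,
  [/\ (u : R^o) \in ideal_gen S, (v : R^o) \in ideal_gen T & z = u + v] >].
have Kcl : GRing.submod_closed K.
  split=> [|a _ _ /asboolP[u [v [uS vT ->]]] /asboolP[u' [v' [u'S v'T ->]]]].
    by apply/asboolP; exists 0, 0; rewrite addr0 !rpred0.
  apply/asboolP; exists (a * u + u'), (a * v + v'); split.
  - exact: (rpredD (rpredZ (a : R) uS) u'S).
  - exact: (rpredD (rpredZ (a : R) vT) v'T).
  - by rewrite addrACA -mulrDr.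
pose KI : ideal R := HB.pack K (GRing.isSubmodClosed.Build R R^o K Kcl).
move=> xST; apply/asboolP; apply: (@ideal_gen_sub R (S `|` T) KI) xST => y Ty.
apply/asboolP; case: Ty => [Sy|Ty].
  by exists y, 0; rewrite addr0 rpred0; split=> //; exact: sub_ideal_gen.
by exists 0, y; rewrite add0r rpred0; split=> //; exact: sub_ideal_gen.
Qed.

(** * The vector space I/mI and minimal generating families *)

Section Fiber.
Variables (R : comNzRingType) (m : maxIdeal R) (I : ideal R).

Lemma fiber_class_eq0 (x : ideal_elt I) :
  (fiber_class m x == 0) = (val x \in ideal_mul m I).
Proof. by rewrite -(raddf0 (@fiber_class R m I)) fiber_class_eq subr0. Qed.

Lemma fiber_class_sum (T : finType) (P : pred T) (c : T -> R) (x : T -> ideal_elt I) :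
  fiber_class m (\sum_(i | P i) c i *: x i) =
  \sum_(i | P i) res m (c i) *: fiber_class m (x i).
Proof. by rewrite raddf_sum; apply: eq_bigr => i _ /=; rewrite -fiber_scaleE. Qed.

Lemma fiber_span s (g : 'I_s -> ideal_elt I) (w : fiber m I) :
  I =i ideal_gen (range (fun i => val (g i))) ->
  exists c, lincomb (@fiber_class R m I \o g) c = w.
Proof.
move=> Ig; have [x <-] := fiber_class_surj w.
have /ideal_genP[c xc] : (val x : R^o) \in ideal_gen (range (fun i => val (g i))).
  by rewrite -Ig; exact: valP.
have -> : x = \sum_i c i *: g i by apply: val_inj; rewrite [LHS]xc raddf_sum.
exists (\row_i res m (c i)); rewrite fiber_class_sum.
by apply: eq_bigr => i _; rewrite mxE.
Qed.

Lemma mu_leq s (g : 'I_s -> ideal_elt I) :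
  I =i ideal_gen (range (fun i => val (g i))) -> (mu m I <= s)%N.
Proof.
move=> Ig; have [|d ds Vd] := @spanned_basis _ _ _ (@fiber_class R m I \o g).
  by move=> w; exact: fiber_span.
by rewrite (muE Vd).
Qed.

(** Generators of [I] span the fiber, so it has finite dimension and [mu] is that dimension, not the
    default value. *)
Lemma fiber_basis : fin_gen I ->
  inhabited (Vector.axiom (mu m I) (fiber m I : lmodType (residue_field m))).
Proof.
move=> /fin_gen_family[s [g Ig]].
have gI i : (g i : R^o) \in I by rewrite Ig; apply: sub_ideal_gen; exists i.
have [|d _ Vd] := @spanned_basis _ _ _ (fun i => fiber_class m (IdealElt (gI i))).
  by move=> w; exact: (@fiber_span s (fun i => IdealElt (gI i))).
by rewrite (muE Vd).
Qed.

(** By Nakayama's lemma, lifts of a basis of I/mI generate [I]. *)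
Lemma mu_generators : local_ring m -> fin_gen I ->
  exists g : 'I_(mu m I) -> R, I =i ideal_gen (range g).
Proof.
move=> Rlocal Ifg; have [[f flin [f' fK f'K]]] := fiber_basis Ifg.
have /choice[g gE] i := fiber_class_surj (f' (delta_mx 0 i)).
exists (fun i => val (g i)) => x; apply/idP/idP; last first.
  by move: x; apply: ideal_gen_sub => _ [i _ <-]; exact: valP.
move: x; apply: (nakayama Rlocal Ifg) => x xI.
(* Lifts to [R] of the coordinates of the class of [x] in that basis. *)
pose c i : R := repr (f (fiber_class m (IdealElt xI)) 0 i).
exists (\sum_i c i * val (g i)); first by apply/ideal_genP; exists c.
have -> : x - \sum_i c i * val (g i) = val (IdealElt xI - \sum_i c i *: g i).
  by rewrite raddfB [X in _ = _ - X]raddf_sum.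
rewrite -fiber_class_eq fiber_class_sum; apply/eqP/(can_inj fK).
pose hL := GRing.isLinear.Build _ _ _ _ f flin.
pose h : {linear fiber m I -> 'rV[residue_field m]_(mu m I)} := HB.pack f hL.
rewrite -[RHS]/(h _) linear_sum [LHS]row_sum_delta; apply: eq_bigr => i _.
by rewrite linearZ /= /h /= gE f'K /c /res reprK.
Qed.

End Fiber.

(** * The number [ms], Steinitz exchange and nonemptiness *)

Section Ms.
Variables (R : comNzRingType) (m : maxIdeal R).
Hypotheses (Rnoeth : noetherian R) (Rlocal : local_ring m).

(** The ideal [m] itself competes in the minimum, so the minimum exists and the default value is not
    taken. *)
Lemma ms_spec : mu_values m (ms m) /\ forall d, mu_values m d -> (ms m <= d)%N.
Proof.
rewrite /ms; case: xgetP => [_ _ //|nomin]; exfalso.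
have ex : exists d, `[< mu_values m d >].
  by exists (mu m m); apply/asboolP; exists m; split=> //; exact: ideal_mul_subr.
case: (ex_minnP ex) => d /asboolP dmu dmin; apply: (nomin d); split=> // e emu.
by apply/dmin/asboolP.
Qed.

Lemma ms_leq s (g : 'I_s -> R) : (forall i, (g i : R^o) \in m) ->
  {subset ideal_mul m m <= ideal_gen (range g)} -> (ms m <= s)%N.
Proof.
move=> gm m2g; have gg i : (g i : R^o) \in ideal_gen (range g).
  by apply: sub_ideal_gen; exists i.
apply: leq_trans (@mu_leq R m (ideal_gen (range g)) s (fun i => IdealElt (gg i)) _).
  by apply: ms_spec.2; exists (ideal_gen (range g)); split=> //;
    apply: ideal_gen_sub => _ [i _ <-].
by [].
Qed.

Lemma ms_generators : exists g : 'I_(ms m) -> R,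
  (forall i, (g i : R^o) \in m) /\ {subset ideal_mul m m <= ideal_gen (range g)}.
Proof.
have [I [Im m2I <-]] := ms_spec.1.
have [g Ig] := mu_generators Rlocal (Rnoeth I).
exists g; split=> [i|x /m2I]; last by rewrite Ig.
by apply: Im; rewrite Ig; apply: sub_ideal_gen; exists i.
Qed.

(** For [y] in [m], this is linear independence over the residue field of the classes in m/m^2,
    phrased with coefficients in [R]. *)
Definition indep_mod_sqr a (y : 'I_a -> R) :=
  forall c : 'I_a -> R, (\sum_i c i * y i : R^o) \in ideal_mul m m ->
  forall i, (c i : R^o) \in m.

Definition fcons (T : Type) a (x : T) (y : 'I_a -> T) (i : 'I_a.+1) : T :=
  oapp y x (unlift ord0 i).

Lemma fcons0 T a (x : T) (y : 'I_a -> T) : fcons x y ord0 = x.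
Proof. by rewrite /fcons unlift_none. Qed.

Lemma fcons_lift T a (x : T) (y : 'I_a -> T) i : fcons x y (lift ord0 i) = y i.
Proof. by rewrite /fcons liftK. Qed.

(** A relation with a unit coefficient at [x] would put [x] in (y) + m^2. So that coefficient is in
    [m], its term is in m^2, and a relation among the [y i] remains. *)
Lemma indep_mod_sqr_cons a (y : 'I_a -> R) (x : R) : (x : R^o) \in m ->
  (x : R^o) \notin ideal_gen (range y `|` [set` ideal_mul m m]) ->
  indep_mod_sqr y -> indep_mod_sqr (fcons x y).
Proof.
move=> xm xJ yind c; rewrite big_ord_recl fcons0.
under eq_bigr do rewrite fcons_lift.
set t := \sum_i _ => ct; have c0 : (c ord0 : R^o) \in m.
  apply: contraNT xJ => /(local_unit Rlocal)[b bc].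
  have -> : x = b * (c ord0 * x + t) - b * t.
    by rewrite mulrDr addrK mulrA bc mul1r.
  apply: (@rpredB _ (ideal_gen (range y `|` [set` ideal_mul m m]))).
    apply: (rpredZ b); apply: sub_ideal_gen; right; exact: ct.
  apply: (rpredZ b); apply: rpred_sum => i _; apply: (rpredZ (c (lift ord0 i))).
  by apply: sub_ideal_gen; left; exists i.
have tm2 : (t : R^o) \in ideal_mul m m.
  rewrite -(addKr (c ord0 * x) t) addrC.
  by apply: (rpredB (S := ideal_mul m m)) => //; exact: ideal_mulS.
move=> i; have [j ->|->//] := unliftP ord0 i.
exact: (yind (fun j => c (lift ord0 j))).
Qed.

(* A Steinitz exchange: elements of [m] independent modulo [m^2] displace,
   one at a time, elements of a generating family of minimal length. *)
Lemma ms_exchange a b (y : 'I_a -> R) (z : 'I_b -> R) : (a + b = ms m)%N ->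
  (forall i, (y i : R^o) \in m) -> (forall j, (z j : R^o) \in m) ->
  indep_mod_sqr y ->
  {subset ideal_mul m m <= ideal_gen (range y `|` range z)} ->
  exists x : 'I_(ms m) -> R, [/\ forall i, (x i : R^o) \in m, indep_mod_sqr x
    & {subset ideal_mul m m <= ideal_gen (range x)}].
Proof.
elim: b a y z => [|b IHb] a y z ab ym zm yind m2yz.
  rewrite addn0 in ab; subst a; exists y; split=> // x /m2yz.
  move: x; apply: ideal_gen_sub => x [yx|[[]//]]; exact: sub_ideal_gen.
pose J := ideal_gen (range y `|` [set` ideal_mul m m]).
(* Here [J] is (y) + m^2. Avoiding [J] keeps the longer family independent; the last condition lets
   [x] replace [z j] without shrinking the ideal. *)
suff [j [x [xm xJ xz]]] : exists j (x : R), [/\ (x : R^o) \in m, (x : R^o) \notin J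
    & (z j : R^o) \in ideal_gen (range (fcons x y) `|` range (z \o lift j))].
  apply: (IHb a.+1 (fcons x y) (z \o lift j)) => //.
  - by rewrite addSnnS.
  - by move=> i; rewrite /fcons; case: unlift.
  - by move=> i; exact: zm.
  - exact: indep_mod_sqr_cons.
  - move=> w /m2yz; move: w; apply: ideal_gen_sub => _ [[i _ <-]|[i _ <-]].
      apply: sub_ideal_gen; left; exists (lift ord0 i) => //.
      exact: fcons_lift.
    have [l ->|->//] := unliftP j i.
    by apply: sub_ideal_gen; right; exists l.
have [[j zJ]|zJ] := pselect (exists j, (z j : R^o) \notin J).
  exists j, (z j); split=> //; apply: sub_ideal_gen; left.
  by exists ord0; rewrite ?fcons0.
have {}zJ j : (z j : R^o) \in J.
  by apply/negPn/negP => zj; apply: zJ; exists j.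
(* Now every [z j] is in [J], so [x] must come from elsewhere. The ideal [K], which is (y) m + m^3,
   contains mJ and lies in m^2. *)
pose K := ideal_gen ([set` ideal_mul (ideal_gen (range y)) m] `|`
                     [set` ideal_mul m (ideal_mul m m)]).
have yK (c x : R) : (c : R^o) \in m -> (x : R^o) \in ideal_gen (range y) ->
    (c * x : R^o) \in K.
  by move=> cm xy; apply: sub_ideal_gen; left; rewrite mulrC; exact: ideal_mulS.
have m3K (c x : R) : (c : R^o) \in m -> (x : R^o) \in ideal_mul m m ->
    (c * x : R^o) \in K.
  by move=> cm xm; apply: sub_ideal_gen; right; exact: ideal_mulS.
have JK (c x : R) : (c : R^o) \in m -> (x : R^o) \in J -> (c * x : R^o) \in K.
  move=> cm /ideal_gen_setU[u [v [uy vm ->]]]; rewrite mulrDr.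
  apply: (@rpredD _ K); first exact: yK.
  by apply: m3K => //; move: v vm; exact: ideal_gen_sub.
have Km2 : {subset K <= ideal_mul m m}.
  have ysub : {subset ideal_gen (range y) <= m}.
    by apply: ideal_gen_sub => _ [i _ <-].
  apply: ideal_gen_sub => x [|]; move: x.
    by apply: ideal_mul_sub => u v uy vm; apply: ideal_mulS => //; exact: ysub.
  exact: ideal_mul_subr.
(* If all such products were in [K], then m^2 = (y) m + m^3 would lie in (y) by Nakayama's lemma,
   and [a] elements, fewer than [ms m], would suffice. *)
have [x [w [xm wm xwK]]] : exists x w : R,
    [/\ (x : R^o) \in m, (w : R^o) \in m & (x * w : R^o) \notin K].
  apply: contrapT => nxw.
  have m2K : {subset ideal_mul m m <= K}.
    apply: ideal_mul_sub => x w xm wm; apply/negPn/negP => xwK.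
    by apply: nxw; exists x, w.
  suff : (ms m <= a)%N by rewrite -ab -[leqRHS]addn0 leq_add2l.
  apply: ms_leq ym _; apply: (nakayama Rlocal (Rnoeth _)) => x /m2K.
  move=> /ideal_gen_setU[u [v [uy vm ->]]].
  exists u; last by rewrite addrC addKr; move: v vm; exact: ideal_gen_sub.
  move: u uy; apply: ideal_gen_sub; apply: ideal_mul_sub => s t sy _.
  by rewrite mulrC; exact: (rpredZ t sy).
have xJ : (x : R^o) \notin J by apply: contraNN xwK => xJ; rewrite mulrC JK.
have /m2yz/ideal_gen_setU[u [v [uy vz xwE]]] : (x * w : R^o) \in ideal_mul m m.
  exact: ideal_mulS.
have /ideal_genP[c uE] := uy; have /ideal_genP[d vE] := vz.
(* If all [d j] were in [m], then [v] would be in mJ, hence in [K] and in m^2. So [u] would be in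
   m^2, independence would put all [c i] in [m], and [x * w] would be in [K]. *)
have [j dj] : exists j, (d j : R^o) \notin m.
  apply: contrapT => dm.
  have vK : (v : R^o) \in K.
    rewrite vE; apply: rpred_sum => j _; apply: JK => //.
    by apply/negPn/negP => dj; apply: dm; exists j.
  have cm : forall i, (c i : R^o) \in m.
    apply: yind; rewrite -uE -(addrK v u) -xwE.
    by apply: (rpredB (S := ideal_mul m m)); [exact: ideal_mulS | exact: Km2].
  move/negP: xwK; apply; rewrite xwE; apply: (@rpredD _ K) => //.
  rewrite uE; apply: rpred_sum => i _; apply: yK => //.
  by apply: sub_ideal_gen; exists i.
have [b' b'd] := local_unit Rlocal dj.
exists j, x; split=> //; set L := ideal_gen _.
(* The unit coefficient [d j] allows solving for [z j]. *)
have zE : z j = b' * (w * x - u - \sum_i d (lift j i) * z (lift j i)).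
  rewrite [w * x]mulrC xwE [u + v]addrC addrK vE (bigD1_ord j) //= addrK.
  by rewrite mulrA b'd mul1r.
rewrite zE; apply: (rpredZ b'); apply: (@rpredB _ L).
  apply: (@rpredB _ L).
    apply: (rpredZ w); apply: sub_ideal_gen; left; exists ord0 => //.
    exact: fcons0.
  move: u uy {xwE uE zE}; apply: ideal_gen_sub => _ [i _ <-].
  by apply: sub_ideal_gen; left; exists (lift ord0 i); rewrite ?fcons_lift.
apply: rpred_sum => i _; apply: (rpredZ (d (lift j i))).
by apply: sub_ideal_gen; right; exists i.
Qed.

Lemma reduction_tuples_nonempty : @reduction_tuples R m (ms m) !=set0.
Proof.
have [g [gm m2g]] := ms_generators.
(* The exchange starts from the empty independent family. *)
have [|||||x [xm xind m2x]] := @ms_exchange 0 (ms m) (fun=> 0) g => //.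
- by move=> i; exact: (rpred0 m).
- by move=> c _ [].
- by move=> x /m2g; move: x; apply: ideal_gen_sub => x gx; apply: sub_ideal_gen; right.
pose X i := IdealElt (xm i).
exists [ffun i => fiber_class m (X i)], X; split=> // [i|u].
  (* An [x i] in m^2 would be a relation modulo m^2 with coefficient 1, which is not in [m]. *)
  apply/negP => xi; have := (max_idealP m).1; apply/negP/negPn.
  have := xind (fun j => (j == i)%:R) _ i; rewrite eqxx; apply.
  rewrite (bigD1 i) //= eqxx mul1r big1 ?addr0// => j /negPf ->.
  by rewrite mul0r.
have xx : ideal_gen (range (fun i => val (X i))) =i ideal_gen (range x) by [].
apply/idP/idP => [um2|]; last first.
  move: u; apply: ideal_mul_sub => u v ux vm; apply: ideal_mulS => //.
  by move: u ux; apply: ideal_gen_sub => _ [i _ <-]; exact: xm.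
have /m2x/ideal_genP[c uE] := um2.
rewrite ideal_mulC; apply/(ideal_mul_genP _ _ xx).
by exists c => //; apply: xind; rewrite -uE.
Qed.

End Ms.

(** * Zariski open conditions on families of vectors *)

Section Zariski.
Variables (k : fieldType) (N : nat).
Implicit Types (U : set 'rV[k]_N) (w : 'rV[k]_N).

(** Openness is local on basic open sets: conversely, the polynomials whose nonvanishing locus lies
    in [U] together define [U]. *)
Lemma zariski_openP U : zariski_open U <->
  forall v, U v -> exists p : {mpoly k[N]}, p.@[fun i => v 0 i] != 0 /\
    forall w, p.@[fun i => w 0 i] != 0 -> U w.
Proof.
split=> [[S ->] v [p Sp pv]|Uloc]; first by exists p; split=> // w pw; exists p.
exists [set p : {mpoly k[N]} | forall w, p.@[fun i => w 0 i] != 0 -> U w].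
apply/seteqP; split=> [v /Uloc[p [pv pU]]|v [p /= pU /pU//]].
by exists p.
Qed.

Lemma zariski_openI U U' :
  zariski_open U -> zariski_open U' -> zariski_open (U `&` U').
Proof.
move=> /zariski_openP Uo /zariski_openP U'o; apply/zariski_openP => v [Uv U'v].
have [p [pv pU]] := Uo _ Uv; have [q [qv qU]] := U'o _ U'v.
exists (p * q); split=> [|w]; first by rewrite mevalM mulf_neq0.
by rewrite mevalM mulf_eq0 negb_or => /andP[/pU ? /qU ?].
Qed.

Lemma zariski_open_forall (T : finType) (U : T -> set 'rV[k]_N) :
  (forall i, zariski_open (U i)) -> zariski_open [set w | forall i, U i w].
Proof.
move=> Uo; apply/zariski_openP => v Uv.
have /choice[p pE] i := (zariski_openP (U i)).1 (Uo i) v (Uv i).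
exists (\prod_i p i); split=> [|w].
  by rewrite rmorph_prod; apply/prodf_neq0 => i _; have [] := pE i.
rewrite rmorph_prod => /prodf_neq0 pw i; have [_] := pE i; apply.
exact: pw.
Qed.

Variables (V : lmodType k) (b : nat).
Hypothesis Vb : inhabited (Vector.axiom b V).
Variables (T J : finType) (H : T -> J -> V) (P : T -> J -> {mpoly k[N]}).

(** Vectors varying polynomially with [w], a form shared by the classes of the x_i in m/m^2 and of
    the products x_i e_l in m^2/m^3. *)
Let F w t := \sum_j (P t j).@[fun i => w 0 i] *: H t j.

Lemma zariski_open_neq0 t : zariski_open [set w | F w t != 0].
Proof.
case: Vb => -[f flin [f' fK _]]; apply/zariski_openP => v /= Fv.
pose hL := GRing.isLinear.Build _ _ _ _ f flin.
pose h : {linear V -> 'rV[k]_b} := HB.pack f hL.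
(* The [s]-th coordinate of [F w t] in a basis of [V], as a polynomial in [w]. *)
pose p s : {mpoly k[N]} := \sum_j h (H t j) 0 s *: P t j.
have pE w s : (p s).@[fun i => w 0 i] = h (F w t) 0 s.
  rewrite raddf_sum (linear_sum h) summxE; apply: eq_bigr => j _.
  by rewrite (linearZ_LR h) mxE /= mevalZ mulrC.
have [s hs] : exists s, h (F v t) 0 s != 0.
  apply: contrapT => /forallNP h0; case/eqP: Fv; apply: (can_inj fK).
  rewrite -![f _]/(h _) linear0; apply/rowP => s; rewrite mxE.
  by apply/eqP/negPn/negP.
exists (p s); rewrite pE; split=> // w; rewrite pE.
by apply: contraNneq => ->; rewrite linear0 mxE.
Qed.

(* If the family spans at [v], its matrix has a left inverse [c] there, and it
   keeps spanning wherever the product of its matrix by the constant [c] is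
   invertible. *)
Lemma zariski_open_spanning :
  zariski_open [set w | forall u, exists c, u = \sum_t c t *: F w t].
Proof.
case: Vb => -[f flin [f' fK f'K]]; apply/zariski_openP => v /= Fv.
pose hL := GRing.isLinear.Build _ _ _ _ f flin.
pose h : {linear V -> 'rV[k]_b} := HB.pack f hL.
have /choice[c cE] (s : 'I_b) := Fv (f' (delta_mx 0 s)).
pose M : 'M[{mpoly k[N]}]_b :=
  \matrix_(s, s') \sum_t \sum_j (c s t * h (H t j) 0 s') *: P t j.
pose Mw w := map_mx (meval (fun i => w 0 i)) M.
have ME w s : row s (Mw w) = h (\sum_t c s t *: F w t).
  apply/rowP => s'; rewrite !mxE raddf_sum (linear_sum h) summxE.
  apply: eq_bigr => t _; rewrite (linearZ_LR h) mxE raddf_sum (linear_sum h).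
  rewrite summxE mulr_sumr; apply: eq_bigr => j _.
  by rewrite (linearZ_LR h) mxE /= mevalZ mulrAC mulrA.
have detE w : (\det M).@[fun i => w 0 i] = \det (Mw w) by rewrite -det_map_mx.
exists (\det M); rewrite detE; split=> [|w].
  suff -> : Mw v = 1%:M by rewrite det1 oner_eq0.
  by apply/row_matrixP => s; rewrite ME row1 -cE; exact: f'K.
(* The rows of [Mw w] are coordinates of vectors in the span of the family; [a] expresses [u]
   through them. *)
rewrite detE -unitfE -unitmxE => Mu u; pose a := h u *m invmx (Mw w).
exists (fun t => \sum_s a 0 s * c s t); apply: (can_inj fK).
rewrite -![f _]/(h _) -[LHS](mulmxKV Mu) -/a mulmx_sum_row.
under [LHS]eq_bigr do rewrite ME -linearZ.
rewrite -linear_sum; congr (h _); under [RHS]eq_bigr do rewrite scaler_suml.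
rewrite exchange_big; apply: eq_bigr => s _; rewrite scaler_sumr.
by apply: eq_bigr => t _; rewrite scalerA.
Qed.

End Zariski.

(** * Openness of the set of reductions *)

Section Reduction.
Variables (R : comNzRingType) (m : maxIdeal R).
Hypotheses (Rnoeth : noetherian R) (Rlocal : local_ring m).
Variables (n r : nat) (e : 'I_r -> ideal_elt m) (emin : minimal_generators e).

Lemma valM_sqr (x y : ideal_elt m) :
  (val x * val y : R^o) \in ideal_mul m m.
Proof. by apply: ideal_mulS; exact: valP. Qed.

(** The multiplication from m/m^2 to m^2/m^3, kept on representatives. *)
Definition sqr_class (x y : ideal_elt m) : fiber m (ideal_mul m m) :=
  fiber_class m (IdealElt (valM_sqr x y)).

(** Changing [x] by an element of m^2 changes its product with [e l] by an element of m^3. *)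
Lemma sqr_class_lincomb (x : ideal_elt m) (c : 'I_r -> residue_field m) l :
  fiber_class m x = \sum_j c j *: fiber_class m (e j) ->
  sqr_class x (e l) = \sum_j c j *: sqr_class (e j) (e l).
Proof.
have /choice[a aE] j := res_surj (c j).
under eq_bigr do rewrite -aE; rewrite -fiber_class_sum => /eqP.
rewrite fiber_class_eq => xa; apply/eqP.
under eq_bigr do rewrite -aE; rewrite -fiber_class_sum fiber_class_eq.
rewrite raddfB [X in _ - X]raddf_sum /=.
have -> : val x * val (e l) - \sum_j a j * (val (e j) * val (e l)) =
    val (e l) * (val x - \sum_j a j * val (e j)).
  by rewrite mulrBr mulr_sumr mulrC; congr (_ - _); apply: eq_bigr => j _;
    rewrite [RHS]mulrC mulrA.
apply: ideal_mulS; first exact: valP.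
by move: xa; rewrite raddfB [X in _ - X]raddf_sum.
Qed.

(** Forward, coefficients in [m] are expanded in the generators [e l]. Backward, spanning gives m^2
    inside (x) m + m^3, and Nakayama's lemma removes m^3. *)
Lemma reduction_spanning (x : 'I_n -> ideal_elt m) :
  ideal_mul m m =i ideal_mul (ideal_gen (range (fun i => val (x i)))) m <->
  forall u, exists c, u = \sum_(t : 'I_n * 'I_r) c t *: sqr_class (x t.1) (e t.2).
Proof.
set X := ideal_gen _; have eE := emin.2.
have xX i : (val (x i) : R^o) \in X by apply: sub_ideal_gen; exists i.
split=> [mE u|xspan z].
  have [[z zm2] <-] := fiber_class_surj u.
  have XE : X =i ideal_gen (range (fun i => val (x i))) by [].
  have := zm2; rewrite mE ideal_mulC => /(ideal_mul_genP _ _ XE)[d dm zE].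
  have /choice[c cE] i : exists c, d i = \sum_l c l * val (e l).
    by apply/ideal_genP; rewrite -eE.
  exists (fun t => res m (c t.1 t.2)); rewrite -fiber_class_sum.
  congr fiber_class; apply: val_inj; rewrite [RHS]raddf_sum /= zE.
  rewrite -(pair_bigA _ (fun i l => c i l * (val (x i) * val (e l)))) /=.
  apply: eq_bigr => i _; rewrite cE mulr_suml; apply: eq_bigr => l _.
  by rewrite -mulrA [val (e l) * _]mulrC.
have Xm : {subset ideal_mul X m <= ideal_mul m m}.
  apply: ideal_mul_sub => u v uX vm; apply: ideal_mulS => //.
  by move: u uX; apply: ideal_gen_sub => _ [i _ <-]; exact: valP.
apply/idP/idP; last exact: Xm.
move: z; apply: (nakayama Rlocal (Rnoeth _)) => z zm2.
have [c cE] := xspan (fiber_class m (IdealElt zm2)).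
pose y := \sum_(t : 'I_n * 'I_r)
  repr (c t) *: IdealElt (valM_sqr (x t.1) (e t.2)).
exists (val y).
  rewrite raddf_sum; apply: rpred_sum => t _; apply: (rpredZ (repr (c t))).
  by apply: ideal_mulS => //; exact: valP.
rewrite -[z]/(val (IdealElt zm2)) -raddfB -fiber_class_eq cE fiber_class_sum.
by apply/eqP/eq_bigr => t _; rewrite /res reprK.
Qed.

Lemma reduction_tuples_open :
  zariski_open (@coord_map R m n r e @^-1` @reduction_tuples R m n).
Proof.
pose P (i : 'I_n) (j : 'I_r) : {mpoly (residue_field m)[n * r]} :=
  'X_(mxvec_index i j).
(* [U1] says that no x_i is in m^2, and [U2] that the products x_i e_l span m^2/m^3. *)
pose U1 : set 'rV[residue_field m]_(n * r) := [set w | forall i,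
  \sum_j (P i j).@[fun q => w 0 q] *: fiber_class m (e j) != 0].
pose U2 : set 'rV[residue_field m]_(n * r) := [set w | forall u, exists c,
  u = \sum_(t : 'I_n * 'I_r)
    c t *: \sum_j (P t.1 j).@[fun q => w 0 q] *: sqr_class (e j) (e t.2)].
suff -> : @coord_map R m n r e @^-1` @reduction_tuples R m n = U1 `&` U2.
  have basis I := fiber_basis m (Rnoeth I); apply: zariski_openI.
    apply: zariski_open_forall => i.
    exact: (zariski_open_neq0 (basis m) (fun _ j => fiber_class m (e j)) P i).
  exact: (zariski_open_spanning (basis (ideal_mul m m))
    (fun t j => sqr_class (e j) (e t.2)) (fun t => P t.1)).
have key w (x : 'I_n -> ideal_elt m) :
    coord_map e w = [ffun i => fiber_class m (x i)] ->
    forall i, fiber_class m (x i) =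
      \sum_j (P i j).@[fun q => w 0 q] *: fiber_class m (e j).
  move=> /ffunP xE i; have := xE i; rewrite !ffunE => <-.
  by apply: eq_bigr => j _; rewrite mevalXU mxE.
apply/seteqP; split=> w.
  move=> [x [/key xE xm2 mE]]; split=> [i|u] /=.
    by rewrite -xE fiber_class_eq0.
  have [c ->] := (reduction_spanning x).1 mE u; exists c.
  by apply: eq_bigr => t _; rewrite (sqr_class_lincomb _ (xE t.1)).
(* Any representatives serve, since both conditions depend only on the classes. *)
move=> [xn0 xspan]; have /choice[x xE] i := fiber_class_surj (coord_map e w i).
have wE : coord_map e w = [ffun i => fiber_class m (x i)].
  by apply/ffunP => i; rewrite [RHS]ffunE xE.
exists x; split=> // [i|].
  by rewrite -fiber_class_eq0 (key _ _ wE); exact: xn0.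
apply/reduction_spanning => u; have [c ->] := xspan u; exists c.
by apply: eq_bigr => t _; rewrite (sqr_class_lincomb _ (key _ _ wE t.1)).
Qed.

End Reduction.

Theorem proposition2p9 (R : comNzRingType) (m : maxIdeal R)
    (Rnoeth : noetherian R) (Rlocal : local_ring m)
    (n : nat) (msR : ms m = n)
    (r : nat) (e : 'I_r -> ideal_elt m) (emin : minimal_generators e) :
  (@reduction_tuples R m n) !=set0 /\
  zariski_open (@coord_map R m n r e @^-1` @reduction_tuples R m n).

Proof.
subst n; split; first exact: reduction_tuples_nonempty.
exact: reduction_tuples_open.
Qed.
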